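(* Consider the interval game associated to a finite collection $\varphi_1,\dots,\varphi_m$ (the enemies) of orientation-preserving $C^1$ diffeomorphisms of $S^1$, and $\psi=R_\theta$ a rigid rotation through angle $\theta\in(0,1)$, where $\theta$ is irrational and well approximated from the left. Suppose there is a point $p\in S^1$ at which the derivatives $\varphi_i'(p)$ are all different from $1$. Then there is a winning interval $I$ contained in any subinterval $J$ sufficiently close to $p$; that is, there is a neighborhood $N$ of $p$ such that every nondegenerate interval $J\subset N$ contains a winning interval $I$.
   Context: $S^1=\mathbb{R}/\mathbb{Z}$ and $R_\theta:z\mapsto z+\theta$. Interval game: the data are finitely many orientation-preserving homeomorphisms $\varphi_1,\dots,\varphi_m$ of $S^1$ (the enemies) and an orientation-preserving homeomorphism $\psi$ of $S^1$. A closed (nondegenerate, proper) interval $I\subset S^1$ wins if there is a positive integer $n$ such that $\psi^i(I^+)\notin\varphi_j(I)$ for all $j$ and all $0\le i\le n$, and such that $\psi^n(I^+)$ is contained in the interior of $I$, where $I^+$ denotes the rightmost point of $I$ (with respect to the orientation of $S^1$). Well approximated from the left: write the irrational $\theta\in(0,1)$ as a continued fraction $\theta=\frac{1}{a_1+}\frac{1}{a_2+}\frac1{a_3+}\cdots$ with positive integers $a_i$, and define $\theta_0=\theta$, $\theta_1=1-a_1\theta_0$, and $\theta_{k+1}=\theta_{k-1}-a_{k+1}\theta_k$ for $k\ge1$. Then $\theta$ is well approximated from the left if there is a sequence of odd $i\to\infty$ for which $|\theta_i|/|\theta_{i-1}|\to0$. *)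

(* Defs.v *)
From HB Require Import structures.
From mathcomp Require Import all_boot all_order all_algebra.
From mathcomp Require Import all_classical all_reals all_analysis.
From mathcomp Require Import lra.
Import Order.TTheory GRing.Theory Num.Theory.
Import numFieldNormedType.Exports.

Set Implicit Arguments.
Unset Strict Implicit.
Unset Printing Implicit Defensive.

Local Open Scope classical_set_scope.
Local Open Scope ring_scope.
Definition integer (R : realType) (x : R) : bool := x \is a Num.int.

Fact integer_zmod_closed (R : realType) : zmod_closed (@integer R).
Proof. by split=> [|x y xZ yZ]; [exact: rpred0 | exact: rpredB]. Qed.

Definition integers (R : realType) : zmodClosed R :=
  HB.pack_for (zmodClosed R) (@integer R)
    (GRing.isZmodClosed.Build R (@integer R) (@integer_zmod_closed R)).

(* S^1 = R/Z, with the quotient topology and the quotient group law. *)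
Definition circle (R : realType) : Type :=
  quotient_topology (Quotient.quot (integers R)).

Section CircleInstances.
Variable R : realType.

HB.instance Definition _ := Topological.on (circle R).
HB.instance Definition _ := Quotient.on (circle R).
HB.instance Definition _ := GRing.isZmodule.Build (circle R)
  (@Quotient.addqA R (integers R)) (@Quotient.addqC R (integers R))
  (@Quotient.add0q R (integers R)) (@Quotient.addNq R (integers R)).

Definition circle_pi (x : R) : circle R := (\pi_(circle R) x)%qT.

Lemma circle_piD : {morph circle_pi : x y / x + y}.
Proof. exact: (@Quotient.pi_add R (integers R)). Qed.

Lemma circle_piP (x y : R) :
  reflect (circle_pi x = circle_pi y) (x - y \is a Num.int).
Proof.
have -> : (x - y \is a Num.int) =
    (\pi_(Quotient.quot (integers R)) x
       == \pi_(Quotient.quot (integers R)) y)%qT.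
  exact: (Quotient.idealrBE (integers R)).
by apply: (iffP eqP).
Qed.

Lemma circle_pi_continuous : continuous circle_pi.
Proof. exact: pi_continuous. Qed.

End CircleInstances.

Arguments circle_pi {R} x.

Section CircleMaps.
Variable R : realType.
Implicit Types (f : circle R -> circle R) (p z : circle R).

(* The representative of z in [-1/2, 1/2[. *)
Definition circle_coord z : R :=
  repr z - (Num.floor (repr z + 2^-1))%:~R.

Lemma circle_coordK : cancel circle_coord circle_pi.
Proof.
move=> z; rewrite -[RHS]reprK; apply/circle_piP.
by rewrite /circle_coord addrAC subrr add0r rpredN intr_int.
Qed.

Lemma circle_coord_pi (x : R) :
  - 2^-1 <= x < 2^-1 -> circle_coord (circle_pi x) = x.
Proof.
move=> /andP[x1 x2]; rewrite /circle_coord.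
have /intrP[k Ek] : repr (circle_pi x) - x \is a Num.int.
  by apply/circle_piP; exact: reprK.
have -> : repr (circle_pi x) = k%:~R + x by rewrite -Ek subrK.
suff -> : Num.floor (k%:~R + x + 2^-1) = k by rewrite addrAC subrr add0r.
by apply: floor_def; rewrite intrD mulr1z; lra.
Qed.

(* f in the charts of R/Z centred at p and at f p. *)
Definition circle_chart f p (t : R) : R :=
  circle_coord (f (p + circle_pi t) - f p).

Definition circle_derive f p : R := derive1 (circle_chart f p) 0.

Definition circle_C1 f :=
  (forall p, derivable (circle_chart f p) 0 1) /\ continuous (circle_derive f).

Definition circle_C1_diffeo f :=
  circle_C1 f /\
  exists g, [/\ circle_C1 g, cancel f g & cancel g f].

Definition orientation_preserving_C1_diffeo f :=
  circle_C1_diffeo f /\ forall p, 0 < circle_derive f p.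

Definition circle_rotation (theta : R) z := z + circle_pi theta.

End CircleMaps.

Section IntervalGame.
Variable R : realType.
Implicit Types (I J : set (circle R)) (e : circle R).

(* A nondegenerate, proper interval of S^1, open or closed at either end. Since
   J is not the whole circle, the real interval D has length at most 1. *)
Definition circle_interval J :=
  J <> setT /\
  exists D : set R, [/\ is_interval D,
    exists x y, [/\ D x, D y & x < y] & J = circle_pi @` D].

(* I is a closed, nondegenerate, proper interval with rightmost point e. *)
Definition closed_circle_interval I e :=
  exists a b : R, [/\ a < b, b < a + 1, I = circle_pi @` `[a, b]
    & e = circle_pi b].

Definition wins m (phi : 'I_m -> circle R -> circle R)
    (psi : circle R -> circle R) I :=
  exists2 e, closed_circle_interval I e &
  exists n : nat, [/\ (0 < n)%N,
    forall (j : 'I_m) (i : nat), (i <= n)%N -> ~ (phi j @` I) (iter i psi e)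
    & I° (iter n psi e)].

End IntervalGame.

Section ContinuedFractions.
Variable R : realType.
Implicit Types (a : nat -> nat) (theta : R).

(* 1 / (a_(k+1) + 1 / (a_(k+2) + ... + 1 / a_(k+n))), and 0 for n = 0.
   The value a_0 is never used. *)
Fixpoint cfrac a (k n : nat) : R :=
  if n is n'.+1 then ((a k.+1)%:R + cfrac a k.+1 n')^-1 else 0.

Definition cfrac_expansion theta a :=
  (forall i, (0 < a i.+1)%N) /\ cfrac a 0 n @[n --> \oo] --> theta.

(* theta_0 = theta, theta_1 = 1 - a_1 theta_0,
   theta_(k+1) = theta_(k-1) - a_(k+1) theta_k. *)
Fixpoint cfrac_theta theta a (k : nat) : R :=
  if k is k1.+1 then
    if k1 is k2.+1 then
      cfrac_theta theta a k2 - (a k)%:R * cfrac_theta theta a k1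
    else 1 - (a 1%N)%:R * theta
  else theta.

Definition well_approximated_from_left theta :=
  exists2 a, cfrac_expansion theta a &
  exists i : nat -> nat, [/\ forall n, odd (i n), i n @[n --> \oo] --> \oo
    & `|cfrac_theta theta a (i n)| / `|cfrac_theta theta a (i n).-1|
        @[n --> \oo] --> (0 : R)].

End ContinuedFractions.

(* Main.v *)
(* Let q_i be the denominators of the convergents of theta. For odd i,
   q_i theta = - d modulo 1 with d = theta_i > 0, and q_i d <= theta_i / theta_(i-1)
   is arbitrarily small. So I = [b - 2 d, b] satisfies psi^n(b) = b - d for n = q_i,
   and only the enemies constrain b. Near p, if psi^i(b) lies in phi_j(I), then
   phi_j(b) - b is within O(d) of i theta modulo 1; since phi_j' - 1 is bounded away
   from 0, this confines b to a set of diameter O(d). The m (n + 1) such sets have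
   total size O(n d), too little to cover a given interval J. *)
Require Import Defs.
From mathcomp Require Import all_boot all_order all_algebra.
From mathcomp Require Import all_classical all_reals all_analysis.
From mathcomp Require Import ring lra.
Import Order.TTheory GRing.Theory Num.Theory.
Import numFieldNormedType.Exports.
Local Open Scope classical_set_scope.
Local Open Scope ring_scope.

(** * Continued fractions and one-sided approximation *)

Lemma irrational_invB {R : realType} (x : R) (k : nat) :
  irrational x -> irrational (x^-1 - k%:R).
Proof.
move=> irrx [q _ qE]; apply: irrx; exists (q + k%:R)^-1 => //.
by rewrite fmorphV rmorphD /= rmorph_nat qE subrK invrK.
Qed.

Lemma irrational_neq0 {R : realType} (x : R) : irrational x -> x != 0.
Proof.
by move=> irrx; apply/eqP => x0; apply: irrx; exists 0 => //; rewrite rmorph0 x0.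
Qed.

Lemma cfrac_ge0 {R : realType} (a : nat -> nat) k n : 0 <= cfrac R a k n.
Proof.
by elim: n k => [|n IH] k //=; rewrite invr_ge0 addr_ge0.
Qed.

(** Indexed so that [cfrac_den a k] is the denominator of the convergent ending in a_k, which pairs
    it with theta_k. *)
Fixpoint cfrac_den (a : nat -> nat) (k : nat) : nat :=
  if k is k1.+1 then
    if k1 is k2.+1 then cfrac_den a k2 + a k * cfrac_den a k1 else a 1%N
  else 1.

Lemma cfrac_denSS (a : nat -> nat) k :
  cfrac_den a k.+2 = (cfrac_den a k + a k.+2 * cfrac_den a k.+1)%N.
Proof. by []. Qed.

Lemma cfrac_thetaSS {R : realType} (theta : R) (a : nat -> nat) k :
  cfrac_theta theta a k.+2 =
    cfrac_theta theta a k - (a k.+2)%:R * cfrac_theta theta a k.+1.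
Proof. by []. Qed.

Lemma nat_ind2 (P : nat -> Prop) :
  P 0%N -> P 1%N -> (forall k, P k -> P k.+1 -> P k.+2) -> forall k, P k.
Proof.
move=> P0 P1 PS k; suff [] : P k /\ P k.+1 by [].
by elim: k => // k [Pk PSk]; split => //; exact: PS.
Qed.

Section CfracTheta.
Variables (R : realType) (theta : R) (a : nat -> nat).
Local Notation q := (cfrac_den a).
Local Notation th := (cfrac_theta theta a).

(** The factor (-1)^k turns the plus sign in the recurrence of q_k into the minus sign in that of
    theta_k. Once theta_k is known to be positive, the parity of k gives the side from which q_k
    theta approaches an integer. *)
Lemma cfrac_thetaE k :
  exists z : int, th k = (-1) ^+ k * ((q k)%:R * theta) + z%:~R.
Proof.
elim/nat_ind2: k => [||k [z1 E1] [z2 E2]].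
- by exists 0; rewrite expr0 !mul1r addr0.
- by exists 1; rewrite expr1 /= mulN1r addrC.
exists (z1 - (a k.+2)%:Z * z2).
rewrite cfrac_thetaSS E1 E2.
rewrite cfrac_denSS natrD natrM intrD mulrNz intrM.
by rewrite -pmulrn !exprS; ring.
Qed.

(** The two recurrences have opposite signs, so the left side does not depend on [k]. With
    positivity it yields [q k.+1 * th k <= 1], which bounds [q k.+1 * th k.+1] by a ratio of
    consecutive [th]. *)
Lemma cfrac_den_theta k : (q k.+1)%:R * th k + (q k)%:R * th k.+1 = 1.
Proof.
elim: k => [|k IH]; first by rewrite /=; ring.
rewrite -[RHS]IH cfrac_thetaSS.
by rewrite cfrac_denSS natrD natrM; ring.
Qed.

Hypothesis a_gt0 : forall i, (0 < a i.+1)%N.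

Lemma cfrac_den_gt0 k : (0 < q k)%N.
Proof.
elim/nat_ind2: k => [||k qk _] //; first exact: a_gt0.
by rewrite cfrac_denSS addn_gt0 qk.
Qed.

Hypothesis theta_irr : irrational theta.
Hypothesis theta_cfrac : cfrac R a 0 n @[n --> \oo] --> theta.

(* The limit x of the tail cfrac a k satisfies th k.+1 = (x^-1 - a_(k+1)) th k,
   and x^-1 - a_(k+1) is the limit of the next tail, so it is nonnegative. *)
Lemma cfrac_theta_gt0 k : 0 < th k.
Proof.
have lim_gt0 j (x : R) : irrational x -> cfrac R a j n @[n --> \oo] --> x ->
    0 < x.
  move=> irrx cx; rewrite lt_neqAle eq_sym irrational_neq0//=.
  by apply: (cvgr_to_ge cx); near=> n; exact: cfrac_ge0.
suff [x [_ _ []]] : exists x, [/\ irrational x,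
    cfrac R a k n @[n --> \oo] --> x,
    0 < th k & th k.+1 = th k * (x^-1 - (a k.+1)%:R)] by [].
elim: k => [|k [x [irrx cx thk thS]]].
  have theta0 := lim_gt0 _ _ theta_irr theta_cfrac.
  by exists theta; split=> //=; field; rewrite gt_eqF.
have irrx' := irrational_invB _ (a k.+1) irrx.
have cx' : cfrac R a k.+1 n @[n --> \oo] --> x^-1 - (a k.+1)%:R.
  have E n : cfrac R a k.+1 n = (cfrac R a k n.+1)^-1 - (a k.+1)%:R.
    by rewrite /= invrK addrAC subrr add0r.
  rewrite (_ : cfrac R a k.+1 = fun n => (cfrac R a k n.+1)^-1 - (a k.+1)%:R).
    apply: cvgB; last exact: cvg_cst.
    apply: cvgV; first exact: irrational_neq0.
    by move: cx; rewrite -(cvg_shiftS (cfrac R a k)).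
  exact/funext.
have x'0 := lim_gt0 _ _ irrx' cx'.
exists (x^-1 - (a k.+1)%:R); split=> //; first by rewrite thS mulr_gt0.
rewrite cfrac_thetaSS mulrBr (mulrC (a k.+2)%:R).
by rewrite thS mulfK// gt_eqF.
Unshelve. all: by end_near.
Qed.

End CfracTheta.

(* The witness is n = q_i with i odd, for which q_i theta = - theta_i modulo 1
   and q_i theta_i <= theta_i / theta_(i-1). *)
Lemma left_approx_small {R : realType} (theta eta : R) :
    irrational theta -> well_approximated_from_left theta -> 0 < eta ->
  exists (n : nat) (z : int) (d : R),
    [/\ (0 < n)%N, 0 < d, n%:R * theta = z%:~R - d & n%:R * d <= eta].
Proof.
move=> irr [a [a0 cva] [i [iodd _ ratio]]] eta0.
have th0 := cfrac_theta_gt0 _ _ _ irr cva.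
move/cvgrPdist_le : ratio => /(_ _ eta0)[k _ /(_ k (leqnn k))].
case ik : (i k) (iodd k) => [//|j]; rewrite -[j.+1.-1]/j => oddj.
rewrite sub0r normrN ger0_norm => [ratio|]; last by rewrite divr_ge0.
have [z zE] := cfrac_thetaE _ theta a j.+1.
exists (cfrac_den a j.+1), z, (cfrac_theta theta a j.+1); split=> //.
- exact: cfrac_den_gt0.
- by rewrite zE -signr_odd oddj expr1; ring.
apply: le_trans ratio.
rewrite !gtr0_norm// ler_pdivlMr// mulrAC ler_piMl ?(ltW (th0 _))//.
rewrite -[leRHS](cfrac_den_theta _ theta a j) lerDl.
by rewrite mulr_ge0// ltW.
Qed.

(** * Topology and charts of the circle *)

Section CircleTopology.
Variable R : realType.
Implicit Types (f : circle R -> circle R) (p z : circle R).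

Lemma circle_pi0 : circle_pi 0 = 0 :> circle R.
Proof. by apply: (addrI (circle_pi 0)); rewrite -circle_piD !addr0. Qed.

Lemma circle_pi_eq (x y : R) :
  circle_pi x = circle_pi y -> exists z : int, x - y = z%:~R.
Proof. by move/circle_piP/intrP. Qed.

(** For the quotient topology, the saturation of [A] must be open; it is the union of the integer
    translates of [A]. *)
Lemma circle_pi_open (A : set R) : open A -> open (circle_pi @` A).
Proof.
move=> oA; rewrite /open /= /quotient_open.
have -> : \pi_(circle R)%qT @^-1` (circle_pi @` A)
    = \bigcup_(z : int) ((fun x : R => x + z%:~R) @^-1` A).
  apply/seteqP; split=> x /=.
    move=> [y Ay /circle_pi_eq[z zE]].
    by exists z => //=; rewrite -zE addrC subrK.
  move=> [z _ /= Az]; exists (x + z%:~R) => //.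
  by apply/circle_piP; rewrite addrAC subrr add0r intr_int.
apply: bigcup_open => z _; apply: open_comp => // x _.
by apply: cvgD; [exact: cvg_id | exact: cvg_cst].
Qed.

Lemma circle_pi_nbhs (x : R) (A : set R) :
  nbhs x A -> nbhs (circle_pi x) (circle_pi @` A).
Proof.
move=> /nbhs_interior; rewrite nbhsE => -[B [oB Bx] BA].
rewrite nbhsE; exists (circle_pi @` B).
  by split; [exact: circle_pi_open | exists x].
by apply: image_subset => y /BA /interior_subset.
Qed.

Lemma iter_circle_rotation (theta : R) n z :
  iter n (circle_rotation theta) z = z + circle_pi (n%:R * theta).
Proof.
elim: n => [|n IH]; first by rewrite mul0r circle_pi0 addr0.
by rewrite iterS IH /circle_rotation -addrA -circle_piD -[n.+1]addn1 natrD
   mulrDl mul1r.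
Qed.

Lemma circle_chart0 f p : circle_chart f p 0 = 0.
Proof.
by rewrite /circle_chart circle_pi0 addr0 subrr -circle_pi0 circle_coord_pi//; lra.
Qed.

Lemma circle_chartE f p t :
  f (p + circle_pi t) = f p + circle_pi (circle_chart f p t).
Proof. by rewrite /circle_chart circle_coordK [RHS]addrC subrK. Qed.

(** Keeps chart values away from the jump of [circle_coord] at 1/2. *)
Lemma near_circle_chart f p (e : R) : derivable (circle_chart f p) 0 1 ->
  0 < e -> \forall t \near 0, `|circle_chart f p t| < e.
Proof.
move=> /derivable1_diffP/differentiable_continuous ctf e0.
have ctf' : circle_chart f p t @[t --> 0] --> (0 : R).
  by rewrite -[X in _ --> X](circle_chart0 f p).
near=> t; rewrite -[_ t]opprK normrN -sub0r; near: t.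
exact: cvgr_dist_lt.
Unshelve. all: by end_near.
Qed.

(* The two charts differ by an integer, and both are smaller than 1/4. *)
Lemma circle_chart_is_derive f p t :
    (forall z, derivable (circle_chart f z) 0 1) ->
    `|circle_chart f p t| < 4^-1 ->
    is_derive t 1 (circle_chart f p) (circle_derive f (p + circle_pi t)).
Proof.
move=> df gt.
pose h := circle_chart f (p + circle_pi t).
(* Near [t], the chart at [p] is a constant plus the chart [h] recentred by the shift, so its
   derivative at [t] is that of [h] at 0. *)
apply: (@near_eq_is_derive _ _ _
    (cst (circle_chart f p t) + (h \o shift (- t)))).
  rewrite (near_shift 0 t) subr0.
  have := near_circle_chart f (p + circle_pi t) 4^-1 (df _).
  move=> /(_ ltac:(by rewrite invr_gt0)); apply: filterS => s /= hs.
  have E : f (p + circle_pi (s + t)) - f p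
      = circle_pi (circle_chart f p t + h s).
    rewrite [s + t]addrC (circle_piD t) (addrA p) circle_chartE -/h circle_chartE.
    by rewrite addrAC (addrAC (f p)) subrr add0r circle_piD.
  rewrite addrfctE /= addrK [RHS]/circle_chart E circle_coord_pi//.
  by move: gt hs; rewrite -/h !ltr_norml; lra.
have dh : is_derive (shift (- t) t) 1 h (circle_derive f (p + circle_pi t)).
  by rewrite /= subrr /circle_derive derive1E; exact/derivableP/df.
have dc := is_derive1_comp dh (is_derive_shift t 1 (- t)).
have dk := is_derive_cst (circle_chart f p t) t 1.
have := is_deriveD dk dc; rewrite add0r mulr1; exact.
Qed.

(* A single small e serves as radius and as both Lipschitz constants: the
   property is stable under decreasing e, so it holds for all enemies at once. *)
Lemma circle_chart_bilipschitz f p : circle_C1 f -> circle_derive f p != 1 ->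
  \forall e \near 0^'+, forall s t : R, `|s| < e -> `|t| < e ->
    e * `|circle_chart f p s - circle_chart f p t| <= `|s - t| /\
    e * `|s - t| <= `|(circle_chart f p s - s) - (circle_chart f p t - t)|.
Proof.
move=> [df cdf] d1; set g := circle_chart f p; set d := circle_derive f p.
(* Half the gap: a derivative within [c] of [d] stays at distance more than [c] from 1. *)
pose c := `|d - 1| / 2.
have c0 : 0 < c by rewrite divr_gt0// normr_gt0 subr_eq0.
have cvd : circle_derive f (p + circle_pi t) @[t --> (0 : R)] --> d.
  have -> : d = circle_derive f (circle_pi (circle_coord p + 0)).
    by rewrite addr0 circle_coordK.
  have E t : circle_derive f (p + circle_pi t)
      = circle_derive f (circle_pi (circle_coord p + t)).
    by rewrite circle_piD circle_coordK.
  rewrite (funext E).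
  apply: (continuous_comp (f := fun t => circle_pi (circle_coord p + t))
    (g := circle_derive f)); last exact: cdf.
  apply: (continuous_comp (f := fun t => circle_coord p + t)
    (g := circle_pi)); last exact: circle_pi_continuous.
  by apply: cvgD; [exact: cvg_cst | exact: cvg_id].
have /nbhs_ballP[r /= r0 rP] : \forall t \near (0 : R),
    `|g t| < 4^-1 /\ `|d - circle_derive f (p + circle_pi t)| < c.
  near=> t; split; near: t; first by apply: near_circle_chart => //; lra.
  exact: cvgr_dist_lt.
have rd (t : R) : `|t| < r ->
    is_derive t 1 g (circle_derive f (p + circle_pi t)) /\
    `|d - circle_derive f (p + circle_pi t)| < c.
  move=> tr; have [|? ?] := rP t; first by rewrite /ball /= sub0r normrN.
  by split=> //; apply: circle_chart_is_derive.
near=> e; have e0 : 0 < e by near: e; exact: nbhs_right_gt.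
have er : e < r by near: e; exact: nbhs_right_lt.
have ec : e < c by near: e; exact: nbhs_right_lt.
(* Near [p] the derivative is at most [|d| + c] in absolute value, whence the first inequality;
   [e < c] gives the second. *)
have eL : e < (`|d| + c)^-1.
  by near: e; apply: nbhs_right_lt; rewrite invr_gt0 ltr_wpDl.
move=> s t; wlog st : s t / s <= t => [hw sr tr|].
  have [st|/ltW ts] := leP s t; first exact: hw.
  by rewrite distrC (distrC (_ - s)) (distrC s); apply: hw.
move=> sr tr.
have inr (x : R) : x \in `[s, t] -> `|x| < r.
  rewrite in_itv /= => /andP[sx xt]; move: sr tr; rewrite !ltr_norml; lra.
have [x xst gE] : exists2 x, x \in `[s, t] &
    g t - g s = circle_derive f (p + circle_pi x) * (t - s).
  apply: MVT_segment => //.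
    by move=> x /subset_itv_oo_cc /inr /rd[].
  apply: derivable_within_continuous => x /inr /rd[]; by case.
have [_] := rd _ (inr _ xst).
set D := circle_derive f (p + circle_pi x) in gE * => Dd.
rewrite -[`|s - t|]distrC -[`|g s - g t|]distrC gE.
have -> : g s - s - (g t - t) = (1 - D) * (t - s) by move: gE; lra.
have u0 : 0 <= t - s by rewrite subr_ge0.
rewrite !normrM (ger0_norm u0); split.
  rewrite mulrA ler_piMl//.
  have DL : `|D| <= `|d| + c.
    by rewrite -[D](subKr d) (le_trans (ler_normB _ _))// lerD2l ltW.
  have dc0 : 0 < `|d| + c by rewrite ltr_wpDl.
  apply: (@le_trans _ _ ((`|d| + c)^-1 * (`|d| + c))).
    by apply: ler_pM => //; exact: ltW.
  by rewrite mulVf// gt_eqF.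
apply: ler_wpM2r => //.
have : `|d - 1| <= `|d - D| + `|1 - D|.
  by rewrite -normrN opprB [leRHS]addrC -[`|d - D|]normrN opprB
     (le_trans _ (ler_normD _ _))// addrA subrK.
have -> : `|d - 1| = c + c by rewrite /c; lra.
by move: Dd ec; clear; lra.
Unshelve. all: by end_near.
Qed.

End CircleTopology.

(** * Choice of the endpoint *)

(** Among [#|T| + 1] points with spacing [w], each [bad i] contains at most one. *)
Lemma pigeonhole_spaced {R : realDomainType} (T : finType) (w x0 : R)
    (bad : T -> R -> Prop) : 0 <= w ->
    (forall i x y, bad i x -> bad i y -> `|x - y| < w) ->
  exists2 k : nat, (k <= #|T|)%N & forall i, ~ bad i (x0 + k%:R * w).
Proof.
move=> w0 badw; apply/not_exists2P => allbad.
have /choice[f fP] (k : 'I_#|T|.+1) : exists i, bad i (x0 + k%:R * w).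
  have [|] := allbad k; first by rewrite -ltnS ltn_ord.
  by move/existsNP => [i /contrapT]; exists i.
suff /leq_card : injective f by rewrite card_ord ltnn.
have lef (k l : 'I_#|T|.+1) : (k < l)%N -> f k <> f l.
  move=> kl fkl; have := badw _ _ _ (fP l); rewrite -fkl => /(_ _ (fP k)).
  have -> : x0 + l%:R * w - (x0 + k%:R * w) = (l - k)%:R * w.
    by rewrite (natrB _ (ltnW kl)); ring.
  rewrite normrM normr_nat (ger0_norm w0) ltNge ler_peMl//.
  by rewrite ler1n subn_gt0.
move=> k l fkl; apply/val_inj; case: (ltngtP k l) => // kl.
    by have := lef _ _ kl.
by have := lef _ _ kl (esym fkl).
Qed.

Lemma intr_norm_lt1 {R : realDomainType} (z : int) :
  `|z%:~R : R| < 1 -> z = 0.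
Proof.
by rewrite -intr_norm ltrz1 -abszE ltz_nat ltnS leqn0 absz_eq0 => /eqP.
Qed.

(* For fixed j and i, the bad endpoints b lie in a set of diameter at most
   4 d / e^2; there are only (n + 1) m such sets, so (n + 1) m + 1 points with
   spacing 5 d / e^2 contain a good one. *)
Lemma exists_avoiding_endpoint {R : realType} m (g : 'I_m -> R -> R)
    (c : 'I_m -> R) (theta e t0 l d : R) (n : nat) :
    0 < e <= 1 -> 0 < l -> - (e ^+ 2 / 16) < t0 -> t0 + l < e ^+ 2 / 16 ->
    (forall j s t, `|s| < e -> `|t| < e ->
      e * `|g j s - g j t| <= `|s - t| /\
      e * `|s - t| <= `|(g j s - s) - (g j t - t)|) ->
    (0 < n)%N -> 0 < d -> n%:R * d <= l * e ^+ 2 / (40 * m.+1%:R) ->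
  exists b, [/\ t0 + 2 * d <= b, b <= t0 + l &
    forall j i t z, (i <= n)%N -> b - 2 * d <= t <= b ->
      g j t - b + c j - i%:R * theta <> z%:~R].
Proof.
move=> /andP[e0 e1] l0 t0r tlr glip n0 d0 nd.
have e2 : 0 < e ^+ 2 by rewrite exprn_gt0.
have ee : e ^+ 2 <= e by rewrite expr2 ler_piMl// ltW.
have m0 : 0 < 40 * m.+1%:R :> R by rewrite mulr_gt0.
have dle : 40 * m.+1%:R * (n%:R * d) <= l * e ^+ 2.
  by move: nd; rewrite ler_pdivlMr// mulrC.
have n1 : 1 <= n%:R :> R by rewrite ler1n.
have m1 : 1 <= m.+1%:R :> R by rewrite ler1n.
have dnd : d <= n%:R * d by rewrite ler_peMl// ltW.
have dmnd : n%:R * d <= m.+1%:R * (n%:R * d).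
  by rewrite ler_peMl// (le_trans _ dnd)// ltW.
have d40 : 40 * d <= l * e ^+ 2 by lra.
have d40l : 40 * d <= l by rewrite (le_trans d40)// ler_piMr ?(ltW l0)//; lra.
have d320 : 320 * d <= e ^+ 2.
  have : l * e ^+ 2 <= 8^-1 * e ^+ 2 by rewrite ler_wpM2r//; lra.
  lra.
pose w := 5 * d / e ^+ 2.
pose bad (ji : 'I_m * 'I_n.+1) b := t0 + 2 * d <= b <= t0 + l /\
  exists t (z : int), b - 2 * d <= t <= b /\
    g ji.1 t - b + c ji.1 - ji.2%:R * theta = z%:~R.
have w0 : 0 < w by rewrite divr_gt0// mulr_gt0.
have [||k kN kgood] := pigeonhole_spaced _ w (t0 + 2 * d) bad; first exact: ltW.
  move=> [j i] b b' [/= bI [t [z [tI tz]]]] [/= b'I [t' [z' [t'I t'z]]]].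
  have small s : t0 + 2 * d - 2 * d <= s <= t0 + l -> `|s| < e.
    by move=> ?; rewrite ltr_norml; lra.
  have bs : `|b| < e by apply: small; lra.
  have bs' : `|b'| < e by apply: small; lra.
  have ts : `|t| < e by apply: small; lra.
  have ts' : `|t'| < e by apply: small; lra.
  have [gbt _] := glip j b t bs ts.
  have [gbt' _] := glip j b' t' bs' ts'.
  have [gbb' ubb'] := glip j b b' bs bs'.
  have E : g j b - b - (g j b' - b')
      = (z - z')%:~R + (g j b - g j t) - (g j b' - g j t').
    by rewrite intrB -tz -t'z; ring.
  have nbt : `|b - t| <= 2 * d by rewrite ler_norml; lra.
  have nbt' : `|b' - t'| <= 2 * d by rewrite ler_norml; lra.
  have nbb' : `|b - b'| <= e ^+ 2 / 8 by rewrite ler_norml; lra.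
  have A1 : `|g j b - g j t| <= e / 160.
    by rewrite -(ler_pM2l e0) (le_trans gbt)// (le_trans nbt)// mulrA -expr2; lra.
  have A2 : `|g j b' - g j t'| <= e / 160.
    by rewrite -(ler_pM2l e0) (le_trans gbt')// (le_trans nbt')// mulrA -expr2; lra.
  have A3 : `|g j b - g j b'| <= e / 8.
    by rewrite -(ler_pM2l e0) (le_trans gbb')// (le_trans nbb')// mulrA -expr2; lra.
  (* The equations hold only modulo 1; the radius e^2/16 keeps all variations so small that both
     involve the same integer. *)
  have zz : z - z' = 0.
    apply: (@intr_norm_lt1 R).
    have -> : (z - z')%:~R = (g j b - g j b') - (b - b') - (g j b - g j t)
        + (g j b' - g j t') :> R by move: E; lra.
    move: A1 A2 A3 nbb'; rewrite ltr_norml !ler_norml; lra.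
  rewrite zz add0r in E.
  (* Each of [t], [t'] costs at most 2 d. The second inequality of [glip] then gives e^2 |b - b'| <=
     4 d < 5 d. *)
  have U : e * `|g j b - b - (g j b' - b')| <= 4 * d.
    rewrite E; apply: (@le_trans _ _ (e * (`|g j b - g j t| + `|g j b' - g j t'|))).
      by rewrite ler_wpM2l ?ler_normB// ltW.
    by rewrite mulrDr; lra.
  rewrite ltr_pdivlMr// mulrC expr2 -mulrA.
  apply: (@le_lt_trans _ _ (4 * d)); last lra.
  by apply: le_trans U; rewrite ler_wpM2l// ltW.
(* Here k <= m (n + 1) <= 2 (m + 1) n, so k w <= 10 (m + 1) n d / e^2; the 40 in the hypothesis
   makes this at most l / 4. *)
have kw : k%:R * w <= l / 4.
  have kN' : k%:R <= m.+1%:R * (2 * n%:R) :> R.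
    rewrite -!natrM ler_nat (leq_trans kN)// card_prod !card_ord.
    by rewrite leq_mul// mul2n -addnn -addn1 leq_add2l.
  apply: (@le_trans _ _ (m.+1%:R * (2 * n%:R) * w)); first by rewrite ler_wpM2r// ltW.
  rewrite /w mulrA ler_pdivrMr//; lra.
have kw0 : 0 <= k%:R * w by rewrite mulr_ge0// ltW.
exists (t0 + 2 * d + k%:R * w); split; [lra|lra|] => j i t z lein tI Ez.
apply: (kgood (j, inord i)); split; first by lra.
by exists t, z; split=> //=; rewrite inordK.
Qed.

(** * The winning interval *)

Theorem theorem4p14 (R : realType) (m : nat)
    (phi : 'I_m -> circle R -> circle R) (theta : R) (p : circle R)
    (phiC1 : forall j, orientation_preserving_C1_diffeo (phi j))
    (theta01 : 0 < theta < 1) (theta_irr : irrational theta)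
    (theta_wal : well_approximated_from_left theta)
    (dphi_p : forall j, circle_derive (phi j) p != 1) :
  exists2 N, nbhs p N &
    forall J, circle_interval J -> J `<=` N ->
      exists2 I, I `<=` J & wins phi (circle_rotation theta) I.
Proof.
have [e [e0 e1 glip]] : exists e : R, [/\ 0 < e, e <= 1 &
    forall j (s t : R), `|s| < e -> `|t| < e ->
    e * `|circle_chart (phi j) p s - circle_chart (phi j) p t| <= `|s - t| /\
    e * `|s - t| <= `|(circle_chart (phi j) p s - s)
                      - (circle_chart (phi j) p t - t)|].
  near (0 : R)^'+ => e; exists e; split.
  - by near: e; exact: nbhs_right_gt.
  - by near: e; exact: nbhs_right_le.
  near: e; apply: filter_forall => j; apply: circle_chart_bilipschitz => //.
  by have [[]] := phiC1 j.
set P := circle_coord p; pose r := e ^+ 2 / 16.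
have r0 : 0 < r by rewrite divr_gt0// exprn_gt0.
exists (circle_pi @` ball P r).
  by rewrite -{1}[p]circle_coordK; apply/circle_pi_nbhs/nbhsx_ballx.
move=> J [_ [D [Dint [x [y [Dx Dy xy]]] ->{J}]]] DN.
(* [D] may lie over [J] in a sheet far from [P]; [x'] is the lift of the same point near [P], and
   [t0] its coordinate in the chart at [p]. *)
have [x' Px' xx'] : (circle_pi @` ball P r) (circle_pi x).
  by apply: DN; exists x.
have tr : `|x' - P| < r by rewrite distrC.
set t0 := x' - P in tr.
have shiftE (t : R) : circle_pi (x + (t - t0)) = p + circle_pi t.
  rewrite circle_piD -xx' -circle_piD /t0 (_ : x' + _ = P + t); last by ring.
  by rewrite circle_piD circle_coordK.
(* The first bound keeps I inside [D], the second keeps its coordinates below [r]. *)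
pose l := Num.min (y - x) ((r - t0) / 2).
have [l0 lyx ltr] : [/\ 0 < l, l <= y - x & t0 + l < r].
  have : l <= (r - t0) / 2 by rewrite ge_min lexx orbT.
  have : l <= y - x by rewrite ge_min lexx.
  move: tr; rewrite ltr_norml => /andP[_ tr].
  by split=> //; [rewrite lt_min; lra | lra].
have eta0 : 0 < l * e ^+ 2 / (40 * m.+1%:R).
  by rewrite divr_gt0// mulr_gt0// exprn_gt0.
have [n [k [d [n0 d0 nE nd]]]] := left_approx_small theta _ theta_irr theta_wal eta0.
(* The displacement of [p] under [phi j], which converts chart values at [phi j p] to coordinates
   around [p]. *)
pose c j := circle_coord (phi j p) - P.
have [] := exists_avoiding_endpoint m (fun j => circle_chart (phi j) p) c theta e
  t0 l d n _ l0 _ ltr glip n0 d0 nd.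
- by rewrite e0.
- by move: tr; rewrite ltr_norml => /andP[].
move=> b [tb bl bgood].
pose B := x + (b - t0).
have xB : x <= B - 2 * d by rewrite /B; lra.
have By : B <= y by rewrite /B; lra.
exists (circle_pi @` `[B - 2 * d, B]).
  apply: image_subset => z /=; rewrite in_itv /= => /andP[zB Bz].
  by apply: (Dint x y) => //; lra.
exists (circle_pi B).
  exists (B - 2 * d), B; split=> //; first lra.
  have ee : e ^+ 2 <= 1 by rewrite expr_le1// ltW.
  by move: tr ltr; rewrite /r ltr_norml; lra.
exists n; split=> //.
  move=> j i lein [_ [w /= wI <-]].
  have wE : circle_pi w = p + circle_pi (w - x + t0).
    by rewrite -shiftE addrK subrKC.
  rewrite iter_circle_rotation wE circle_chartE /B shiftE.
  rewrite -[phi j p]circle_coordK -[p in RHS]circle_coordK -!circle_piD.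
  move=> /circle_pi_eq[z zE].
  move: wI; rewrite in_itv /= /B => wI.
  apply: (bgood j i (w - x + t0) z lein); first lra.
  by rewrite -zE /c -/P; ring.
(* The endpoint returns to [B - d], the midpoint of I. *)
rewrite iter_circle_rotation nE -circle_piD.
have -> : circle_pi (B + (k%:~R - d)) = circle_pi (B - d).
  by apply/circle_piP; rewrite (_ : _ - _ = k%:~R) ?intr_int//; ring.
have Bd : B - d \in `]B - 2 * d, B[ by rewrite in_itv /=; lra.
apply: circle_pi_nbhs; apply: filterS (near_in_itvoo Bd).
exact: subset_itv_oo_cc.
Unshelve. all: by end_near.
Qed.
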